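(* Let $\mathfrak{C}$ be an open convex cone in $V=\mathbb{R}^s$, and let $f$ be a $\mathfrak{C}$-Lorentzian polynomial of degree $n$ on $V$. Put $\mathrm{Nef}^1(f)=\overline{\mathfrak{C}}$, and let $\overline{\mathrm{Eff}}^1(f)\subset V$ be a closed convex cone containing $\mathrm{Nef}^1(f)$ such that $T\cdot\alpha_1\cdot\ldots\cdot\alpha_{n-1}\ge0$ for all $T\in\overline{\mathrm{Eff}}^1(f)$ and all $\alpha_1,\dots,\alpha_{n-1}\in\mathrm{Nef}^1(f)$. Let $\mathfrak{L}=(L_1,\dots,L_{n-2})$ be a critical collection of classes in $\mathrm{Nef}^1(f)$. Let $\mathcal{C}\subset\overline{\mathrm{Eff}}^1(f)$ be a subset such that - $\overline{\mathrm{cone}}(\mathcal{C})=\overline{\mathrm{Eff}}^1(f)$; - $\mathcal{C}\cap\ker\mathfrak{L}$ is a finite set; - for any $D\in\mathcal{C}$ and any $\alpha_1,\dots,\alpha_{n-3}\in\mathrm{Nef}^1(f)$, the quadratic form $q(x,y)=x\cdot y\cdot D\cdot\alpha_1\cdot\ldots\cdot\alpha_{n-3}$ on $V$ has at most one positive eigenvalue. Fix $r\in[n-2]$. Then for any $\alpha\in\ker\mathfrak{L}$ there exists $\beta\in V$ such that (1) $\beta-\alpha\in\mathrm{span}_{\mathbb{R}}(\mathcal{C}\cap\ker\mathfrak{L})$, and (2) $-\beta^2\cdot\mathfrak{L}_{\setminus r}\in\overline{\mathrm{Eff}}^1(f)^*$.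
   Context: $[m]=\{1,\dots,m\}$. A homogeneous polynomial $f$ of degree $n$ on $\mathbb{R}^s$ is $\mathfrak{C}$-Lorentzian if for all $v_1,\dots,v_n\in\mathfrak{C}$: $D_{v_1}\cdots D_{v_n}f>0$, and the symmetric bilinear form $(\xi,\eta)\mapsto D_\xi D_\eta D_{v_3}\cdots D_{v_n}f$ has exactly one positive eigenvalue ($D_v$ is the directional derivative along $v$). Products: for $\alpha_1,\dots,\alpha_n\in V$, $\alpha_1\cdot\ldots\cdot\alpha_n:=F(\alpha_1,\dots,\alpha_n)=\frac1{n!}D_{\alpha_1}\cdots D_{\alpha_n}f$, the complete polarization of $f$. A product of fewer than $n$ vectors is regarded as the symmetric multilinear form in the remaining arguments; in particular a product of $n-1$ vectors is an element of the dual space $V^*$. $\mathfrak{L}$ also denotes the product $L_1\cdot\ldots\cdot L_{n-2}$, $\mathfrak{L}_{\setminus r}$ the product of all $L_k$ with $k\ne r$, and $\ker\mathfrak{L}=\{\alpha\in V:\mathfrak{L}\cdot\alpha=0\in V^*\}$. For $v\in\overline{\mathfrak{C}}$, the numerical dimension is $\mathrm{nd}(v)=\max\{k\ge0: F(v,\dots,v,w,\dots,w)>0 \text{ with } v \text{ repeated } k \text{ times and } w \text{ repeated } n-k\text{ times}\}$ for any $w\in\mathfrak{C}$ (this is independent of $w$). The collection $\mathfrak{L}$ is critical if $\mathrm{nd}(\sum_{i\in I}L_i)\ge|I|+1$ for every nonempty $I\subset[n-2]$. $\overline{\mathrm{cone}}(S)$ is the closed convex cone generated by $S$. For a convex cone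 $K\subset V$, $K^*\subset V^*$ is the set of linear functionals that are nonnegative on $K$. *)

(* Defs.v *)
From mathcomp Require Import all_boot all_order all_algebra.
From mathcomp Require Import polyrcf.
From mathcomp Require Import boolp classical_sets cardinality reals.
From mathcomp Require Import topology normedtype.
(* The notations of mpoly are not imported, as they clash with those of
   mathcomp-analysis. *)
From mathcomp Require Import -(notations) mpoly.

Set Implicit Arguments.
Unset Strict Implicit.
Unset Printing Implicit Defensive.

Import Order.TTheory GRing.Theory Num.Theory.
Import numFieldNormedType.Exports.
Local Open Scope classical_set_scope.
Local Open Scope ring_scope.

Section Cones.
Variables (R : realType) (s : nat).
Local Notation V := 'rV[R]_s.

(* Only positive scalars, since an open cone need not contain 0. *)
Definition convex_cone (K : set V) : Prop :=
  (forall x y, K x -> K y -> K (x + y)) /\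
  (forall (t : R) x, 0 < t -> K x -> K (t *: x)).

Definition closed_conic_hull (S : set V) : set V :=
  closure [set v | exists m (c : 'I_m -> R) (u : 'I_m -> V),
    (forall i, 0 <= c i /\ S (u i)) /\ v = \sum_i c i *: u i].

Definition linear_span (S : set V) : set V :=
  [set v | exists m (c : 'I_m -> R) (u : 'I_m -> V),
    (forall i, S (u i)) /\ v = \sum_i c i *: u i].

Definition dual_cone (K : set V) : set (V -> R) :=
  [set phi | scalar phi /\ forall v, K v -> 0 <= phi v].

Definition gram_matrix (q : V -> V -> R) : 'M[R]_s :=
  \matrix_(i, j) q (delta_mx 0 i) (delta_mx 0 j).

(* Eigenvalues are counted with (algebraic) multiplicity; this is only used
   when q is symmetric, so all the eigenvalues of its Gram matrix are real. *)
Definition num_pos_eigenvalues (q : V -> V -> R) : nat :=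
  let chi := char_poly (gram_matrix q) in
  (\sum_(x <- rootsR chi | (0 < x)%R) mup x chi)%N.

End Cones.

Section Lorentzian.
Variables (R : realType) (s : nat).
Local Notation V := 'rV[R]_s.
Implicit Types (f : mpoly s R) (n : nat) (C : set V).

Definition dir_deriv (v : V) f : mpoly s R :=
  \sum_(i < s) v 0 i *: mderiv i f.

(* Value at 0 of D_{v_1} ... D_{v_k} f for vs = [:: v_1; ...; v_k]; when f is
   homogeneous of degree k, this derivative is a constant polynomial. *)
Definition iter_deriv f (vs : seq V) : R :=
  meval (fun=> 0) (foldr dir_deriv f vs).

(* F(v_1, ..., v_n), the product v_1 . ... . v_n; meant for size vs = n. *)
Definition polarization n f (vs : seq V) : R := (n`!%:R)^-1 * iter_deriv f vs.

Definition lorentzian n C f : Prop :=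
  f \is ishomog1 n mdeg /\
  forall vs : seq V, size vs = n -> (forall v, v \in vs -> C v) ->
    0 < iter_deriv f vs /\
    ((2 <= n)%N ->
     num_pos_eigenvalues (fun x y => iter_deriv f [:: x, y & drop 2 vs]) = 1%N).

(* Products of n - 1 vectors are elements of the dual space. *)
Definition product_form n f (vs : seq V) : V -> R :=
  fun v => polarization n f (v :: vs).

Definition kernel n f (vs : seq V) : set V :=
  [set a | forall v, product_form n f (a :: vs) v = 0].

Definition num_dim n f (w v : V) : nat :=
  (\max_(k < n.+1 | (0 < polarization n f (nseq k v ++ nseq (n - k) w))%R) k)%N.

(* The numerical dimension is independent of the choice of w in C. *)
Definition critical n C f m (L : 'I_m -> V) : Prop :=
  forall w, C w -> forall I : {set 'I_m}, I != finset.set0 ->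
    (#|I|.+1 <= num_dim n f w (\sum_(i in I) L i))%N.

End Lorentzian.

(* Main.v *)
(* Write [F] for the polarization of [f], [T(x,y,z)] for
   x . y . z . L_{\setminus r} and fix [w] in [C].  Let [K] be the kernel of the
   product of all [L_k], that is, of [T(L_r, ., .)].

   If [D] is a generator outside [K], then [T(L_r, w, D) > 0], and the reverse
   Cauchy-Schwarz inequality for [T(., ., D)] at [L_r + t w] with [t -> 0] gives
   [T(b, b, D) <= 0] for every [b] in [K]; so only the finitely many generators
   [D_1, ..., D_N] in [K] impose a condition on [beta].  For these it is enough
   that [T(beta, w, D_j) = 0].  Writing [beta = alpha + sum_i c_i D_i], this is
   a symmetric linear system for [c] with matrix [T(D_i, D_j, w)].  It is solvable
   because [T(., ., w)] is negative semidefinite on [K] when [T(L_r, w, w) > 0],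
   which makes the right-hand side orthogonal to the kernel of the matrix.

   If [T(L_r, w, w) = 0], then [K] is the whole space, so the generators are
   finite in number and span it, and [beta = 0] works. *)
From HB Require Import structures.
Require Import Defs.
From mathcomp Require Import all_boot all_order all_algebra.
From mathcomp Require Import polyrcf complex ring lra.
From mathcomp Require Import boolp classical_sets cardinality reals.
From mathcomp Require Import topology normedtype.
From mathcomp Require Import -(notations) mpoly.
Set Implicit Arguments.
Unset Strict Implicit.
Unset Printing Implicit Defensive.
Import Order.TTheory GRing.Theory Num.Theory.
Import numFieldNormedType.Exports.
Local Open Scope classical_set_scope.
Local Open Scope ring_scope.

(** * Symmetric forms with at most one positive eigenvalue *)

Section Spectral.
Local Open Scope sesquilinear_scope.

(** By the spectral theorem [A] is unitarily similar to a real diagonal matrix. The same numbers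
    [e i] are the roots of the characteristic polynomial and the coefficients of the sum of squares,
    so counting roots controls the sign of the form. *)
Lemma hermsym_diagonalization (K : numClosedFieldType) (n : nat) (A : 'M[K]_n) :
  A \is hermsymmx ->
  exists (P : 'M[K]_n) (e : 'I_n -> K),
    [/\ forall i, e i \is Num.real,
        char_poly A = \prod_i ('X - (e i)%:P) &
        forall z : 'rV[K]_n, (z *m A *m z ^t*) 0 0 =
          \sum_i e i * `|(z *m P) 0 i| ^+ 2].
Proof.
move=> hA; have /hermitian_normalmx/orthomx_spectralP defA := hA.
set P := spectralmx A in defA *; set d := spectral_diag A in defA *.
have uP : P \in unitmx by exact: spectral_unit.
have vP : invmx P = P^t* by rewrite invmx_unitary // spectral_unitarymx.
exists (P^t*), (fun i => d 0 i); split.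
- by move=> i; apply: (mxOverP (hermitian_spectral_diag_real hA)).
- have -> : char_poly A = char_poly (diag_mx d).
    pose Q := map_mx polyC P; pose Q' := map_mx polyC (invmx P).
    have QQ' : Q *m Q' = 1%:M by rewrite -map_mxM mulmxV // map_mx1.
    have e1 : char_poly_mx A = Q' *m char_poly_mx (diag_mx d) *m Q.
      rewrite /char_poly_mx mulmxBr mulmxBl {1}defA !map_mxM; congr (_ - _).
      rewrite mul_mx_scalar -scalemxAl /Q' /Q -map_mxM mulVmx // map_mx1.
      by rewrite scalemx1.
    rewrite /char_poly e1 !det_mulmx mulrAC mulrC -det_mulmx.
    rewrite /Q' /Q -map_mxM mulVmx // map_mx1 det1 ?mulr1 ?mul1r //.
  rewrite char_poly_trig ?diag_mx_is_trig //.
  by apply: eq_bigr => i _; rewrite mxE eqxx mulr1n.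
- move=> z; rewrite {1}defA vP !mulmxA.
  set y := z *m P^t*.
  have -> : y *m diag_mx d *m P *m z^t* = y *m diag_mx d *m y^t*.
    by rewrite /y trmx_mul map_mxM /= trmxCK mulmxA.
  rewrite mxE; apply: eq_bigr => i _.
  rewrite mul_mx_diag !mxE normCK; ring.
Qed.

Lemma mup_prod_XsubC (F : fieldType) (I : finType) (e : I -> F) (x : F) :
  mup x (\prod_i ('X - (e i)%:P)) = #|[pred i | e i == x]|.
Proof.
rewrite -sum1_card [RHS]big_mkcond /=.
suff:  (\prod_i ('X - (e i)%:P) != 0) &&
    (mup x (\prod_i ('X - (e i)%:P)) == (\sum_i if e i == x then 1 else 0)%N).
  move=> /andP[_ /eqP ->]; by apply: eq_bigr => i _; rewrite inE.
elim/big_rec2: _ => [|i k p _ /andP[p0 /eqP<-]].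
  by rewrite oner_eq0 /= mupNroot // root1.
rewrite mulf_neq0 ?polyXsubC_eq0 //= mupM ?polyXsubC_eq0 //.
by rewrite -['X - _]expr1 mup_XsubCX; case: eqP.
Qed.

(** Double counting: the multiplicity of [x] is the number of [i] with [e i = x], and every [e i]
    occurs exactly once in the duplicate-free list of roots. *)
Lemma sum_mup_pos (R : rcfType) (I : finType) (e : I -> R) :
  let p := \prod_i ('X - (e i)%:P) in
  (\sum_(x <- rootsR p | (0 < x)%R) mup x p)%N = #|[pred i | 0 < e i]|.
Proof.
move=> p.
have p0 : p != 0 by apply/prodf_neq0 => i _; rewrite polyXsubC_eq0.
rewrite -sum1_card [RHS]big_mkcond.
transitivity (\sum_(x <- rootsR p | (0 < x)%R) \sum_i nat_of_bool (e i == x))%N.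
  by apply: eq_bigr => x _; rewrite mup_prod_XsubC -sum1_card [LHS]big_mkcond;
    apply: eq_bigr => i _; rewrite inE; case: eqP.
rewrite exchange_big /=; apply: eq_bigr => i _.
have ei : e i \in rootsR p.
  have := roots_on_rootsR p0 (e i); rewrite inE /= => <-.
  by rewrite /p /root horner_prod (bigD1 i) //= !hornerE subrr mul0r.
rewrite big_mkcond (bigD1_seq (e i)) ?uniq_roots //= eqxx big1 ?addn0 //.
by move=> x /negbTE; rewrite eq_sym => ->; case: ifP.
Qed.

Lemma hermitian_complete_square (K : numClosedFieldType) (a b d x y : K) :
  b^* = b -> d^* = d ->
  d * (y * (y^* * a) - y * (x^* * b) - (x * (y^* * b) - x * (x^* * d))) =
  (a * d - b ^+ 2) * `|y| ^+ 2 + `|d * x - b * y| ^+ 2.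
Proof. by move=> bJ dJ; rewrite !normCK rmorphB !rmorphM /= bJ dJ; ring. Qed.

(** If the inequality failed, the form would be positive definite on the span of [x] and [y]. With
    at most one positive eigenvalue it is nonpositive on some hyperplane, which such a plane must
    meet. The scalars are extended to the complex numbers to use the spectral theorem. *)
Lemma reverse_cauchy_schwarz_mx (R : realType) (n : nat) (A : 'M[R]_n)
    (x y : 'rV[R]_n) :
  A^T = A ->
  ((\sum_(a <- rootsR (char_poly A) | (0 < a)%R) mup a (char_poly A)) <= 1)%N ->
  let q (u v : 'rV[R]_n) := (u *m A *m v^T) 0 0 in
  0 < q y y -> q x x * q y y <= q x y ^+ 2.
Proof.
move=> symA le1 q qy.
pose c : {rmorphism R -> R[i]} := real_complex R.
have cJ a : (c a)^* = c a by apply/CrealP/complex_realP; exists a.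
have hA : map_mx c A \is hermsymmx.
  apply: realsym_hermsym.
    by apply/is_hermitianmxP; rewrite expr0 scale1r -{1}symA; apply/matrixP => i j;
      rewrite !mxE.
  by apply/mxOverP => i j; rewrite mxE; apply/complex_realP; exists (A i j).
have [P [e [e_real chi norm]]] := hermsym_diagonalization hA.
pose d i := complex.Re (e i).
have ed i : e i = c (d i) by rewrite -[e i]RRe_real.
have chiR : char_poly A = \prod_i ('X - (d i)%:P).
  apply: (map_poly_inj c); rewrite map_char_poly chi rmorph_prod /=.
  by apply: eq_bigr => i _; rewrite rmorphB /= map_polyX map_polyC ed.
rewrite chiR sum_mup_pos in le1.
(* The hyperplane is orthogonal to the eigenvector of the only positive eigenvalue. If there is
   none, the zero vector serves and the hyperplane is the whole space. *)
have [i0 i0P] : exists w : 'cV[R[i]]_n, forall z : 'rV[R[i]]_n,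
    (z *m w) 0 0 = 0 -> (z *m map_mx c A *m z ^t*) 0 0 <= 0.
  have [/existsP[i di] | no_pos] := boolP [exists i, 0 < d i].
    exists (col i P) => z.
    have -> : (z *m col i P) 0 0 = (z *m P) 0 i.
      by rewrite !mxE; apply: eq_bigr => j _; rewrite mxE.
    move=> zi0.
    rewrite norm sumr_le0 // => j _.
    have [->|ji] := eqVneq j i; first by rewrite zi0 normr0 expr0n mulr0.
    rewrite mulr_le0_ge0 ?exprn_ge0 // ed (lecR _ 0) leNgt.
    apply: contraL le1 => dj; rewrite -ltnNge (cardD1 i) inE di add1n ltnS.
    by rewrite (cardD1 j) !inE ji dj.
  exists 0 => z _; rewrite norm sumr_le0 // => j _.
  rewrite mulr_le0_ge0 ?exprn_ge0 // ed (lecR _ 0) leNgt.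
  by move: no_pos; rewrite negb_exists => /forallP /(_ j).
have qC (u v : 'rV[R]_n) :
    (map_mx c u *m map_mx c A *m (map_mx c v)^t*) 0 0 = c (q u v).
  have -> : (map_mx c v)^t* = map_mx c v^T.
    by apply/matrixP => i j; rewrite !mxE cJ.
  by rewrite -!map_mxM mxE.
have sym_q u v : q u v = q v u.
  rewrite /q -[in LHS](trmxK (u *m A *m v^T)) mxE !trmx_mul trmxK symA.
  by rewrite mulmxA.
rewrite leNgt; apply/negP => lt_q.
set X := map_mx c x; set Y := map_mx c y.
pose px := (X *m i0) 0 0; pose py := (Y *m i0) 0 0.
have [py0|py0] := eqVneq py 0.
  by have := i0P _ py0; rewrite qC (lecR _ 0) leNgt qy.
(* This combination of [X] and [Y] lies in the hyperplane. Multiplying the value of the form there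
   by [q y y] and completing the square exhibits it as positive. *)
have := i0P (py *: X - px *: Y).
have -> : ((py *: X - px *: Y) *m i0) 0 0 = 0.
  rewrite /px /py mulmxBl -!scalemxAl.
  by case: (X *m i0) (Y *m i0) => u [v]; rewrite !mxE mulrC subrr.
move=> /(_ erefl).
have -> : (py *: X - px *: Y)^t* = py^* *: X^t* - px^* *: Y^t*.
  by apply/matrixP => i j; rewrite !mxE rmorphB !rmorphM.
rewrite !mulmxBl !mulmxBr -!scalemxAl -!scalemxAr.
move: (qC x x) (qC x y) (qC y x) (qC y y); rewrite -/X -/Y (sym_q y x).
move: (X *m _ *m X^t*) (X *m _ *m Y^t*) (Y *m _ *m X^t*) (Y *m _ *m Y^t*).
move=> xx xy yx yy exx exy eyx eyy; rewrite !mxE exx exy eyx eyy => le0.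
have cqy : 0 < c (q y y) by rewrite (ltcR 0).
have := mulr_ge0_le0 (ltW cqy) le0.
set lhs := (X in X <= _ -> _).
have -> : lhs = c (q x x * q y y - q x y ^+ 2) * `|py| ^+ 2
   + `|c (q y y) * px - c (q x y) * py| ^+ 2.
  have -> : c (q x x * q y y - q x y ^+ 2) = c (q x x) * c (q y y) - c (q x y) ^+ 2.
    by rewrite rmorphB rmorphM rmorphXn.
  exact: hermitian_complete_square (cJ _) (cJ _).
move=> /le_gtF; rewrite ltr_pwDl ?exprn_ge0 // mulr_gt0 ?exprn_gt0 ?normr_gt0 //.
by rewrite (ltcR 0) subr_gt0.
Qed.

Lemma reverse_cauchy_schwarz (R : realType) (n : nat)
    (q : 'rV[R]_n -> 'rV[R]_n -> R) (x y : 'rV[R]_n) :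
  (forall u v, q u v = q v u) -> (forall u, scalar (q u)) ->
  (num_pos_eigenvalues q <= 1)%N ->
  0 < q y y -> q x x * q y y <= q x y ^+ 2.
Proof.
move=> qC ql le1.
have qS u : q u = fun v => \sum_j v 0 j * q u (delta_mx 0 j).
  pose B : {scalar 'rV[R]_n} :=
    HB.pack (q u) (GRing.isLinear.Build R 'rV[R]_n R *%R (q u) (ql u)).
  apply/funext => v; rewrite -[q u]/(B : _ -> _) [in LHS](row_sum_delta v).
  by rewrite linear_sum; apply: eq_bigr => j _; rewrite linearZ.
have qE u v : q u v = (u *m gram_matrix q *m v^T) 0 0.
  rewrite qS mxE; apply: eq_bigr => j _; rewrite !mxE mulrC; congr (_ * _).
  rewrite qC qS; apply: eq_bigr => i _; rewrite mxE; congr (_ * _); exact: qC.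
rewrite !qE; apply: reverse_cauchy_schwarz_mx le1.
by apply/matrixP => i j; rewrite !mxE qC.
Qed.

End Spectral.

(** * Linear functionals and convex cones *)

(** This replaces the limit [t -> 0] in all the perturbation arguments below. *)
Lemma quadratic_ge0_at0 (R : realFieldType) (a b c : R) :
  (forall t, 0 < t -> 0 <= a + b * t + c * t ^+ 2) -> 0 <= a.
Proof.
move=> h; rewrite leNgt; apply/negP => a0.
set K := `|b| + `|c| + 1.
have K0 : 0 < K by rewrite ltr_wpDl // addr_ge0.
have Ka : 0 < K - a by rewrite subr_gt0 (lt_trans a0).
(* Chosen so that [t <= 1] and [K * t < - a]; since [t ^+ 2 <= t], the terms in [b] and [c] together
   stay below [K * t]. *)
pose t := - a / (K - a).
have t0 : 0 < t by rewrite divr_gt0 // oppr_gt0.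
have t1 : t <= 1 by rewrite ler_pdivrMr // mul1r; lra.
have Kt : K * t < - a.
  by rewrite mulrA ltr_pdivrMr // mulrC ltr_pM2l ?oppr_gt0 //; lra.
have := h t t0; rewrite leNgt => /negP; apply.
have bt : b * t <= `|b| * t by rewrite ler_pM2r // ler_norm.
have ct : c * t ^+ 2 <= `|c| * t.
  apply: (@le_trans _ _ (`|c| * t ^+ 2)).
    by rewrite ler_pM2r ?exprn_gt0 // ler_norm.
  by rewrite ler_wpM2l // expr2 ger_pMl.
have -> : a + b * t + c * t ^+ 2 = a + (b * t + c * t ^+ 2) by rewrite addrA.
move: Kt; rewrite /K !mulrDl mul1r; lra.
Qed.

Section Functionals.
Variables (R : realType) (s : nat).
Local Notation V := 'rV[R]_s.
Implicit Types (phi : V -> R) (C K : set V) (u v w : V).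

Lemma scalar_linearP phi : scalar phi -> exists B : {scalar V}, phi = B.
Proof.
move=> h; pose B : {scalar V} :=
  HB.pack phi (GRing.isLinear.Build R V R *%R phi h).
by exists B.
Qed.

Lemma scalar_continuous phi : scalar phi -> continuous phi.
Proof.
move=> /scalar_linearP [B ->].
have -> : (B : V -> R) = fun v => \sum_j v 0 j * B (delta_mx 0 j).
  apply/funext => v; rewrite [in LHS](row_sum_delta v) linear_sum.
  by apply: eq_bigr => j _; rewrite linearZ.
move=> v; apply: (cvg_big _ (nbhs_filter v)) => [|j _]; first exact: add_continuous.
apply: cvgM; [exact: coord_continuous|exact: cvg_cst].
Qed.

(** The half-space where [phi] is nonnegative is closed and stable under conic combinations. *)
Lemma closed_conic_hull_ge0 (S : set V) phi : scalar phi ->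
  (forall v, S v -> 0 <= phi v) ->
  forall v, closed_conic_hull S v -> 0 <= phi v.
Proof.
move=> phi_lin S_ge0; rewrite /closed_conic_hull.
have phi_cl : closed (phi @^-1` [set x | 0 <= x]).
  apply: preimage_closed; last exact: closed_ge.
  by move=> x _; apply: scalar_continuous.
move=> v vS; suff: closure (phi @^-1` [set x | 0 <= x]) v.
  by rewrite -((closure_id _).1 phi_cl).
apply: closureS vS => {v} _ [m [c [u [cu ->]]]] /=.
have [B defB] := scalar_linearP phi_lin; rewrite defB linear_sum sumr_ge0 // => i _.
by rewrite linearZ mulr_ge0 ?(proj1 (cu i)) // -defB; apply: S_ge0; apply: (cu i).2.
Qed.

Lemma closed_conic_hull_eq0 (S : set V) phi : scalar phi ->
  (forall v, S v -> phi v = 0) -> forall v, closed_conic_hull S v -> phi v = 0.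
Proof.
move=> phi_lin S_eq0 v Sv; apply/eqP; rewrite eq_le -oppr_ge0; apply/andP; split.
  apply: (@closed_conic_hull_ge0 S (fun u => - phi u)) => // [a x y|x /S_eq0 ->].
    by rewrite phi_lin opprD mulrN.
  by rewrite oppr0.
by apply: closed_conic_hull_ge0 Sv => // x /S_eq0 ->.
Qed.

Lemma open_absorbing C w v : open C -> C w ->
  exists2 t, 0 < t & C (w + t *: v) /\ C (w - t *: v).
Proof.
move=> C_open Cw.
have cvg0 : (fun t : R => w + t *: v) @ (0 : R) --> w.
  rewrite -[X in _ --> X]addr0 -(scale0r v).
  by apply: cvgD; [exact: cvg_cst | apply: cvgZ; [exact: cvg_id|exact: cvg_cst]].
have /nbhs_ballP[e e0 ballC] := cvg0 _ (open_nbhs_nbhs (conj C_open Cw)).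
exists (e / 2); first by rewrite divr_gt0.
have e2 : `|e / 2| < e by rewrite gtr0_norm ?divr_gt0 //; move: e0 => /=; lra.
split; last rewrite -scaleNr.
all: by apply: ballC; rewrite -ball_normE /= sub0r ?opprK ?normrN.
Qed.

(** For every direction [v], both [w + t *: v] and [w - t *: v] lie in [C] for some [t > 0], so
    [phi v] is both nonnegative and nonpositive. *)
Lemma scalar_ge0_eq0 C phi w : open C -> C w -> scalar phi ->
  (forall v, C v -> 0 <= phi v) -> phi w = 0 -> forall v, phi v = 0.
Proof.
move=> C_open Cw /scalar_linearP[B ->] B_ge0 Bw v.
have [t t0 [/B_ge0 + /B_ge0]] := open_absorbing v C_open Cw.
rewrite linearB linearD /= linearZ /= Bw add0r sub0r oppr_ge0 => tv_ge0 tv_le0.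
have /eqP : t * B v = 0 by apply/eqP; rewrite eq_le tv_ge0 tv_le0.
by rewrite mulf_eq0 gt_eqF //= => /eqP.
Qed.

(** For [v] in [C] close to [u], the vector [u + w - v] is close to [w], hence in [C]; adding [v]
    back gives [u + w]. *)
Lemma closure_add_open_cone C u w : open C -> convex_cone C ->
  closure C u -> C w -> C (u + w).
Proof.
move=> C_open [CD _] Cu Cw.
have [|v [Cv Cuv]] := Cu [set v | C (u + w - v)]; last first.
  by rewrite -(subrK v (u + w)); apply: CD.
have cvgu : (fun v => u + w - v) @ u --> w.
  rewrite -[X in _ --> X](addrK u) [w + u]addrC.
  apply: (cvgB (FF := nbhs_filter u)); last exact: cvg_id.
  exact: (@cvg_cst _ _ _ _ (nbhs_filter u)).
exact: (cvgu _ (open_nbhs_nbhs (conj C_open Cw))).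
Qed.

End Functionals.

(** * The trilinear form x . y . z . L_{\setminus r} *)

(* Only [l + t w] with small [t > 0] is used: the reverse Cauchy-Schwarz
   inequality there reads [t^2 B(u,w)^2 >= 2 t B(u,u) B(l,w) + o(t)] as soon as
   [B(u,u) > 0]; so [B(l,l) = 0] is harmless. *)
Lemma orthogonal_form_le0 (R : realType) (V : lmodType R)
    (B : V -> V -> R) (l u w : V) :
  (forall x y, B x y = B y x) -> (forall x, scalar (B x)) ->
  (forall t : R, 0 < t -> 0 < B (l + t *: w) (l + t *: w) ->
     B u u * B (l + t *: w) (l + t *: w) <= B u (l + t *: w) ^+ 2) ->
  0 <= B l l -> 0 < B l w -> 0 <= B w w -> B u l = 0 -> B u u <= 0.
Proof.
move=> BC Blin rcs ll lw ww ul; rewrite leNgt; apply/negP => uu.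
have BD x y t z : B x (y + t *: z) = B x y + t * B x z.
  by rewrite addrC Blin addrC.
suff : 0 <= - (2 * B u u * B l w).
  by rewrite oppr_ge0 leNgt !mulr_gt0.
apply: (@quadratic_ge0_at0 _ _ (B u w ^+ 2) 0) => t t0.
have yyE : B (l + t *: w) (l + t *: w) = B l l + 2 * t * B l w + t ^+ 2 * B w w.
  by rewrite BD ![B (l + _) _]BC !BD (BC w l); ring.
have tlw : 0 < t * B l w by rewrite mulr_gt0.
have tww : 0 <= t ^+ 2 * B w w by rewrite mulr_ge0 // sqr_ge0.
have yy_ge : 2 * (t * B l w) <= B (l + t *: w) (l + t *: w).
  by rewrite yyE; lra.
have yy_gt0 : 0 < B (l + t *: w) (l + t *: w) by rewrite (lt_le_trans _ yy_ge); lra.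
have := rcs t t0 yy_gt0; rewrite (BD u) ul add0r => le.
have : 2 * (t * B l w) * B u u <= (t * B u w) ^+ 2.
  by apply: le_trans le; rewrite mulrC ler_pM2l.
move=> le2; rewrite -(pmulr_rge0 _ t0).
have -> : t * (- (2 * B u u * B l w) + B u w ^+ 2 * t + 0 * t ^+ 2) =
  (t * B u w) ^+ 2 - 2 * (t * B l w) * B u u by ring.
by rewrite subr_ge0.
Qed.

(** On the line through [x] the form is [2 t B(x,y) + t^2 B(y,y)]. Its linear term dominates near
    [0] and would change sign with [t] unless it vanished. *)
Lemma neg_semidef_isotropic (R : realType) (V : lmodType R)
    (B : V -> V -> R) (x y : V) :
  (forall x y, B x y = B y x) -> (forall x, scalar (B x)) ->
  (forall t : R, B (x + t *: y) (x + t *: y) <= 0) -> B x x = 0 -> B x y = 0.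
Proof.
move=> BC Blin le0 xx.
have BD a b t c : B a (b + t *: c) = B a b + t * B a c.
  by rewrite addrC Blin addrC.
have E t : B (x + t *: y) (x + t *: y) = 2 * t * B x y + t ^+ 2 * B y y.
  by rewrite BD ![B (x + _) _]BC !BD (BC y x) xx; ring.
apply/eqP; rewrite eq_le -oppr_ge0; apply/andP; split.
all: apply: (@quadratic_ge0_at0 _ _ (- (B y y) / 2) 0) => t t0.
  have := le0 t; rewrite E => h.
  have : 0 <= t * (- B x y + - B y y / 2 * t + 0 * t ^+ 2) by lra.
  by rewrite pmulr_rge0.
have := le0 (- t); rewrite E => h.
have : 0 <= t * (B x y + - B y y / 2 * t + 0 * t ^+ 2) by lra.
by rewrite pmulr_rge0.
Qed.

Section Trilinear.
Variables (R : realType) (s : nat).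
Local Notation V := 'rV[R]_s.
Variables (T : V -> V -> V -> R) (C Eff gens : set V) (l w : V).
Hypothesis (TC12 : forall x y z, T x y z = T y x z)
  (TC23 : forall x y z, T x y z = T x z y)
  (T_lin : forall x y, scalar (T x y)).
Hypotheses (C_open : open C) (C_cone : convex_cone C) (Cw : C w) (Cl : closure C l).
Hypotheses (Nef_Eff : closure C `<=` Eff) (gens_Eff : gens `<=` Eff)
  (gens_hull : closed_conic_hull gens = Eff).
Hypothesis T_ge0 : forall x y z, Eff x -> closure C y -> closure C z -> 0 <= T x y z.
(** Two sources of reverse Cauchy-Schwarz. For a generator in the third slot only the signature is
    known, so [T y y D] must be positive. With the interior vector [w] there, the Alexandrov-Fenchel
    inequality holds for all [y] in the closure of [C]. *)
Hypothesis T_rcs : forall D x y, gens D -> 0 < T y y D ->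
  T x x D * T y y D <= T x y D ^+ 2.
Hypothesis T_AF : forall x y, closure C y -> T x x w * T y y w <= T x y w ^+ 2.
Let K : set V := [set a | forall v, T l a v = 0].
Hypothesis gens_ker_fin : finite_set (gens `&` K).

Let TC13 x y z : T x y z = T z y x.
Proof. by rewrite TC23 TC12 TC23. Qed.

Let C_cl v : C v -> closure C v.
Proof. exact: subset_closure. Qed.

Let T_lin1 y z : scalar (fun x => T x y z).
Proof. by move=> a x x' /=; rewrite !(TC13 _ y z) T_lin. Qed.

Let T_lin2 x z : scalar (fun y => T x y z).
Proof. by move=> a y y' /=; rewrite !(TC23 _ _ z) T_lin. Qed.

Let T_vanish x y : (forall v, C v -> 0 <= T x y v) -> T x y w = 0 ->
  forall v, T x y v = 0.
Proof. exact: scalar_ge0_eq0. Qed.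

(** A functional that is nonnegative on [C] and zero at [w] vanishes. This applies in turn to
    [T D w], to [T D v] for [v] in [C], and finally to the remaining slot. *)
Let T_null D : Eff D -> T w w D = 0 -> forall x y, T x y D = 0.
Proof.
move=> ED Twwd.
have D_nef y z : C y -> C z -> 0 <= T D y z by move=> ? ?; apply: T_ge0 => //; exact: C_cl.
have Dww : T D w w = 0 by rewrite TC13.
have Dwv : forall v, T D w v = 0 by apply: T_vanish => // v Cv; exact: D_nef.
have Dv v : C v -> forall y, T D v y = 0.
  move=> Cv; apply: T_vanish => [y Cy|]; first exact: D_nef.
  by rewrite TC23 Dwv.
move=> x y; rewrite TC13; move: x.
apply: (@scalar_ge0_eq0 _ _ C _ w) => //.
- by move=> v Cv; rewrite TC23 Dv.
- by rewrite TC23 Dwv.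
Qed.

Lemma form_le0_on_kernel D b : gens D -> ~ K D -> K b -> T b b D <= 0.
Proof.
move=> gD nKD Kb; have ED := gens_Eff gD.
apply: (orthogonal_form_le0 (B := fun x y => T x y D) (l := l) (w := w)) => //.
- by move=> t t0 /T_rcs; apply.
- by rewrite TC13 T_ge0.
- have lwD_ge0 : 0 <= T l w D by rewrite TC13 T_ge0 //; exact: C_cl.
  (* If [T l w D] were zero, the functional [T l D], nonnegative on [C], would vanish at [w], hence
     everywhere, putting [D] in [K]. *)
  rewrite lt_neqAle lwD_ge0 andbT; apply/eqP => lwD; apply: nKD => v.
  apply: T_vanish; last by rewrite TC23.
  by move=> u Cu; rewrite TC12 T_ge0 //; exact: C_cl.
- by rewrite TC13 T_ge0 //; exact: C_cl.
- by rewrite TC12 Kb.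
Qed.

(** Reverse Cauchy-Schwarz at [y = w] suffices when [T w w D > 0]; otherwise the whole form
    [T(., ., D)] is zero. *)
Lemma form_le0_of_orthogonal D b : gens D -> T b w D = 0 -> T b b D <= 0.
Proof.
move=> gD bwD; have ED := gens_Eff gD.
have : 0 <= T w w D by rewrite TC13 T_ge0 //; exact: C_cl.
rewrite le_eqVlt => /predU1P[/esym wwD|wwD]; first by rewrite T_null.
have := T_rcs b gD wwD; rewrite bwD expr0n /= pmulr_lle0 //.
Qed.

(** Elements of [K] are orthogonal to [l] for the form [T(., ., w)], and [l + t w] lies in [C],
    where the Alexandrov-Fenchel inequality is available. *)
Lemma kernel_form_le0 a : 0 < T l w w -> K a -> T a a w <= 0.
Proof.
move=> lww Ka; apply: (orthogonal_form_le0 (B := fun x y => T x y w) (l := l) (w := w)) => //.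
- move=> t t0 _; apply: T_AF; apply: C_cl.
  apply: closure_add_open_cone => //; exact: C_cone.2.
- by apply: T_ge0; [exact: Nef_Eff | | exact: C_cl].
- by apply: T_ge0; [exact/Nef_Eff/C_cl | exact: C_cl | exact: C_cl].
- by rewrite TC12 Ka.
Qed.

(** A functional that vanishes on the generators vanishes on their closed conic hull [Eff], hence on
    the open set [C], hence everywhere. The functionals tested are the columns of the cokernel of
    the matrix with rows in [S]. *)
Lemma span_eq_setT (S : seq V) : gens = [set` S] -> forall v, linear_span gens v.
Proof.
move=> defS v.
pose M := \matrix_(i < size S) S`_i.
have /submxP [c defv] : (v <= M)%MS.
  rewrite submxE; apply/eqP/rowP => k.
  pose phi (u : V) := (u *m cokermx M) 0 k.
  have phi_lin : scalar phi by move=> a x y; rewrite /phi mulmxDl -scalemxAl !mxE.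
  have phi_gens u : gens u -> phi u = 0.
    rewrite defS /= => /(nthP 0) [i lti <-].
    have -> : S`_i = row (Ordinal lti) M by apply/rowP => j; rewrite !mxE.
    by rewrite /phi -row_mul mulmx_coker !mxE.
  have phi_C u : C u -> phi u = 0.
    by move=> Cu; apply: (closed_conic_hull_eq0 phi_lin phi_gens);
      rewrite gens_hull; apply/Nef_Eff/C_cl.
  rewrite [RHS]mxE; apply: (scalar_ge0_eq0 C_open Cw phi_lin) => [u /phi_C -> //|].
  exact: phi_C.
exists (size S), (fun i => c 0 i), (fun i => S`_i); split.
  by move=> i; rewrite defS /= mem_nth.
rewrite defv mulmx_sum_row; apply: eq_bigr => i _; congr (_ *: _).
by apply/rowP => j; rewrite !mxE.
Qed.

Let T_sum m (c : 'I_m -> R) (u : 'I_m -> V) y z :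
  T (\sum_i c i *: u i) y z = \sum_i c i * T (u i) y z.
Proof.
have [B defB] := scalar_linearP (T_lin1 y z).
rewrite -[LHS]/((fun x => T x y z) _) defB linear_sum; apply: eq_bigr => i _.
by rewrite linearZ -defB.
Qed.

Let T_addl a b y z : T (a + b) y z = T a y z + T b y z.
Proof. by rewrite -[a]scale1r T_lin1 scale1r mul1r. Qed.

Let T_scale t a y z : T (t *: a) y z = t * T a y z.
Proof.
have [B defB] := scalar_linearP (T_lin1 y z).
by rewrite -[LHS]/((fun x => T x y z) _) defB linearZ -defB.
Qed.

Let K_add a b : K a -> K b -> K (a + b).
Proof. by move=> Ka Kb v; rewrite TC12 T_addl !(TC12 _ l) Ka Kb addr0. Qed.

Let K_sum m (c : 'I_m -> R) (u : 'I_m -> V) :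
  (forall i, K (u i)) -> K (\sum_i c i *: u i).
Proof.
by move=> Ku v; rewrite TC12 T_sum big1 // => i _; rewrite TC12 Ku mulr0.
Qed.

(** Fredholm alternative: [c *m M = b] is solvable as soon as [b] annihilates the kernel of the
    symmetric matrix [M]. *)
Lemma exists_span_shift_orthogonal (S : seq V) alpha : 0 < T l w w ->
  K alpha -> (forall D, D \in S -> K D) ->
  exists c : 'I_(size S) -> R,
    let beta := alpha + \sum_i c i *: S`_i in
    forall D, D \in S -> T beta w D = 0.
Proof.
move=> lww Ka KS.
pose M : 'M[R]_(size S) := \matrix_(i, j) T (S`_i) (S`_j) w.
pose b : 'rV[R]_(size S) := \row_j - T alpha (S`_j) w.
have KSi (i : 'I_(size S)) : K S`_i by apply: KS; rewrite mem_nth.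
have /submxP [c defb] : (b <= M)%MS.
  rewrite submxE; apply/eqP; move: (cokermx M) (mulmx_coker M) => N MN.
  apply/rowP => k.
  (* A kernel vector [d] of [M] gives [x] in [K] orthogonal to all of [S], thus isotropic. Negative
     semidefiniteness on [K] then makes [x] orthogonal to [alpha], which says that [b] annihilates
     [d]. *)
  pose d i := N i k; pose x := \sum_i d i *: S`_i.
  have xS (j : 'I_(size S)) : T x (S`_j) w = 0.
    have := congr1 (fun m : 'M_(size S) => m j k) MN.
    rewrite !mxE T_sum => MNjk; rewrite -[RHS]MNjk; apply: eq_bigr => i _.
    by rewrite !mxE TC12 mulrC.
  have xx : T x x w = 0.
    by rewrite T_sum big1 // => i _; rewrite TC12 xS mulr0.
  have Kx t : K (x + t *: alpha).
    apply: K_add; first exact: K_sum.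
    by move=> v; rewrite TC12 T_scale TC12 Ka mulr0.
  have xa : T x alpha w = 0.
    apply: (@neg_semidef_isotropic _ _ (fun x y => T x y w)) => // t.
    exact: kernel_form_le0.
  rewrite [RHS]mxE -[RHS]oppr0 -[X in _ = - X]xa T_sum -sumrN mxE; apply: eq_bigr => i _.
  by rewrite !mxE (TC12 alpha) mulNr mulrC.
exists (fun i => c 0 i) => beta D /(nthP 0) [j ltj <-].
have h := congr1 (fun m : 'rV_(size S) => m 0 (Ordinal ltj)) defb.
rewrite !mxE /= in h.
rewrite TC23 /beta T_addl T_sum; apply/eqP; rewrite addrC addr_eq0 h; apply/eqP.
by apply: eq_bigr => i _; rewrite !mxE.
Qed.

Lemma exists_shift_le0 alpha : K alpha ->
  exists beta : V, linear_span (gens `&` K) (beta - alpha) /\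
    forall v, Eff v -> T beta beta v <= 0.
Proof.
move=> Ka.
have [S defS] := (finite_seqP _).1 gens_ker_fin.
have lww_ge0 : 0 <= T l w w by apply: T_ge0 => //; [exact: Nef_Eff|exact: C_cl|exact: C_cl].
have [lww|lww0] := boolP (0 < T l w w); last first.
  have {lww_ge0} lww : T l w w = 0.
    by apply/eqP; rewrite eq_le lww_ge0 andbT leNgt.
  (* The degenerate case of [T_null] is used with [l] itself as the element of [Eff]. *)
  have KT a : K a by move=> v; rewrite TC13; apply: T_null; [exact: Nef_Eff | rewrite TC13].
  have gensK : gens `&` K = gens by apply/seteqP; split=> [x [] //|x gx]; split.
  exists 0; split; last by move=> v _; rewrite -(scale0r w) T_scale mul0r.
  by rewrite gensK; apply: (@span_eq_setT S); rewrite -gensK.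
have KS D : D \in S -> K D.
  by move=> SD; have : (gens `&` K) D by [rewrite defS]; case.
have [c] := exists_span_shift_orthogonal lww Ka KS.
set beta := alpha + _ => /= orth; exists beta; split.
  exists (size S), c, (fun i => S`_i); split; last by rewrite /beta addrAC subrr add0r.
  by move=> i; rewrite defS /= mem_nth.
have Kb : K beta by apply: K_add => //; apply: K_sum => i; apply: KS; rewrite mem_nth.
move=> v Ev; rewrite -oppr_ge0; move: v Ev; rewrite -gens_hull.
apply: (@closed_conic_hull_ge0 _ _ gens (fun v => - T beta beta v)).
  by move=> a x y; rewrite T_lin opprD mulrN.
move=> D gD; rewrite oppr_ge0.
have [KD|nKD] := pselect (K D); last exact: form_le0_on_kernel.
apply: form_le0_of_orthogonal => //; apply: orth.
by have : (gens `&` K) D by []; rewrite defS.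
Qed.

End Trilinear.

(** * Polarization *)

Section Polarization.
Variables (R : realType) (s : nat).
Local Notation V := 'rV[R]_s.
Implicit Types (f : mpoly s R) (C : set V) (u v x y : V) (vs : seq V).

Lemma dir_deriv_linear v (a : R) f g :
  dir_deriv v (a *: f + g) = a *: dir_deriv v f + dir_deriv v g.
Proof.
rewrite /dir_deriv scaler_sumr -big_split; apply: eq_bigr => i _.
by rewrite mderivD mderivZ scalerDr !scalerA mulrC.
Qed.

Lemma dir_deriv_linear_dir (a : R) u v f :
  dir_deriv (a *: u + v) f = a *: dir_deriv u f + dir_deriv v f.
Proof.
rewrite /dir_deriv scaler_sumr -big_split; apply: eq_bigr => i _.
by rewrite !mxE scalerDl scalerA.
Qed.

Lemma dir_derivC u v f : dir_deriv u (dir_deriv v f) = dir_deriv v (dir_deriv u f).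
Proof.
have E a b : dir_deriv a (dir_deriv b f) =
    \sum_(i < s) \sum_(j < s) (a 0 i * b 0 j) *: mderiv i (mderiv j f).
  apply: eq_bigr => i _; rewrite /dir_deriv (raddf_sum (mderiv i)) scaler_sumr.
  by apply: eq_bigr => j _; rewrite /= mderivZ scalerA.
rewrite !E exchange_big; apply: eq_bigr => i _; apply: eq_bigr => j _.
by rewrite mderiv_comm mulrC.
Qed.

Lemma foldr_dir_deriv_perm f vs1 vs2 : perm_eq vs1 vs2 ->
  foldr (@dir_deriv R s) f vs1 = foldr (@dir_deriv R s) f vs2.
Proof.
elim: vs1 vs2 => [|v vs1 IH] vs2 eq12.
  by have /perm_nilP -> : perm_eq vs2 [::] by rewrite perm_sym.
have vvs2 : v \in vs2 by rewrite -(perm_mem eq12) mem_head.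
case/splitPr: vvs2 eq12 => p1 p2.
rewrite perm_sym -cat1s perm_catCA /= perm_cons perm_sym => /IH ->.
by elim: p1 => //= x p1 <-; rewrite dir_derivC.
Qed.

Lemma polarization_perm n f vs1 vs2 : perm_eq vs1 vs2 ->
  polarization n f vs1 = polarization n f vs2.
Proof. by rewrite /polarization /iter_deriv => /foldr_dir_deriv_perm ->. Qed.

Lemma polarization_scalar n f vs : scalar (fun x => polarization n f (x :: vs)).
Proof.
move=> a u v; rewrite /polarization /iter_deriv /= dir_deriv_linear_dir.
by rewrite mevalD mevalZ mulrDr mulrCA.
Qed.

Lemma polarization_addZ n f vs u v (t : R) :
  polarization n f (u + t *: v :: vs) =
  polarization n f (u :: vs) + t * polarization n f (v :: vs).
Proof. by rewrite addrC (polarization_scalar n f vs t v u) addrC. Qed.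

Lemma polarizationC12 n f x y vs :
  polarization n f [:: x, y & vs] = polarization n f [:: y, x & vs].
Proof. by apply: polarization_perm; rewrite -(cat1s x) -(cat1s y) perm_catCA. Qed.


Lemma lorentzian_reverse_cauchy_schwarz n C f x y vs :
  lorentzian n C f -> (2 <= n)%N -> size vs = (n - 2)%N ->
  (forall v, v \in vs -> C v) -> C y ->
  polarization n f [:: x, x & vs] * polarization n f [:: y, y & vs]
    <= polarization n f [:: x, y & vs] ^+ 2.
Proof.
move=> [_ f_lor] n2 sz Cvs Cy.
pose q a b := iter_deriv f [:: a, b & vs].
have yyvs v : v \in [:: y, y & vs] -> C v.
  by rewrite !inE => /predU1P[->|/predU1P[->|/Cvs]].
have sz2 : size [:: y, y & vs] = n by rewrite /= sz -addn2 subnK.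
have [qyy /(_ n2) /= q1] := f_lor _ sz2 yyvs.
rewrite drop0 in q1.
(* Both sides carry the factor [1/n!] squared; the signature is given for the unnormalized
   derivatives. *)
rewrite /polarization mulrACA exprMn -expr2 ler_pM2l; last first.
  by rewrite exprn_gt0 // invr_gt0 ltr0n fact_gt0.
apply: (reverse_cauchy_schwarz (q := q)) => //; rewrite ?q1 //.
  by move=> u v; rewrite /q /iter_deriv /= dir_derivC.
move=> u a v v'; rewrite /q /iter_deriv /= dir_deriv_linear_dir.
by rewrite dir_deriv_linear mevalD mevalZ.
Qed.

(** Boundary vectors are pushed into [C] by adding [t *: w], one slot at a time. Each inequality is
    then quadratic in [t], and its constant term is the claim. *)
Lemma lorentzian_alexandrov_fenchel n C f x y vs :
  open C -> convex_cone C -> C !=set0 -> lorentzian n C f -> (2 <= n)%N ->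
  size vs = (n - 2)%N -> (forall v, v \in vs -> closure C v) -> closure C y ->
  polarization n f [:: x, x & vs] * polarization n f [:: y, y & vs]
    <= polarization n f [:: x, y & vs] ^+ 2.
Proof.
move=> C_open C_cone [w Cw] f_lor n2 sz Cvs Cy.
have C_shift u t : closure C u -> 0 < t -> C (u + t *: w).
  by move=> Cu t0; apply: closure_add_open_cone => //; apply: C_cone.2.
wlog {Cy} Cy : y / C y.
  move=> h; rewrite -subr_ge0.
  pose F := polarization n f.
  apply: (@quadratic_ge0_at0 _ _
    (2 * F [:: x, y & vs] * F [:: x, w & vs]
      - 2 * F [:: x, x & vs] * F [:: y, w & vs])
    (F [:: x, w & vs] ^+ 2 - F [:: x, x & vs] * F [:: w, w & vs])) => t t0.
  have := h _ (C_shift y t Cy t0); rewrite -subr_ge0; congr (0 <= _).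
  rewrite -/F; have FD := polarization_addZ n f; rewrite -/F in FD.
  have FC := polarizationC12 n f; rewrite -/F in FC.
  rewrite [F [:: x, y + _ & _]]FC FD FD [F [:: y, y + _ & _]]FC [F [:: w, y + _ & _]]FC.
  by rewrite !FD [F [:: w, y & _]]FC [F [:: y, x & _]]FC [F [:: w, x & _]]FC; ring.
(* [s1] holds the boundary vectors still to be perturbed and [s2] the interior ones; the induction
   moves the head of [s1], once perturbed, into [s2]. *)
suff gen (s1 s2 : seq V) : size (s1 ++ s2) = (n - 2)%N ->
    (forall v, v \in s1 -> closure C v) -> (forall v, v \in s2 -> C v) ->
    polarization n f [:: x, x & s1 ++ s2] * polarization n f [:: y, y & s1 ++ s2]
    <= polarization n f [:: x, y & s1 ++ s2] ^+ 2.
  by have := gen vs [::]; rewrite cats0; apply.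
elim: s1 s2 => [|a s1 IH] s2 sz12 Cs1 Cs2.
  exact: (lorentzian_reverse_cauchy_schwarz _ f_lor).
pose F u v z := polarization n f [:: z, u, v & s1 ++ s2].
have pull u v z : polarization n f [:: u, v & s1 ++ z :: s2] = F u v z.
  apply: polarization_perm; apply/permPl.
  exact: (perm_catCA [:: u, v & s1] [:: z] s2).
have FaE u v : polarization n f [:: u, v & (a :: s1) ++ s2] = F u v a.
  apply: polarization_perm; apply/permPl.
  exact: (perm_catCA [:: u; v] [:: a] (s1 ++ s2)).
have FD u v t : F u v (a + t *: w) = F u v a + t * F u v w by exact: polarization_addZ.
rewrite !{}FaE -subr_ge0.
apply: (@quadratic_ge0_at0 _ _
  (2 * F x y a * F x y w - F x x a * F y y w - F x x w * F y y a)
  (F x y w ^+ 2 - F x x w * F y y w)) => t t0.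
have sz' : size (s1 ++ (a + t *: w :: s2)) = (n - 2)%N.
  by rewrite -sz12 !size_cat /= addnS.
have Cs1' v : v \in s1 -> closure C v.
  by move=> vs1; apply: Cs1; rewrite inE vs1 orbT.
have C2 v : v \in a + t *: w :: s2 -> C v.
  by rewrite inE => /predU1P[->|/Cs2 //]; apply: C_shift => //; apply/Cs1/mem_head.
have := IH _ sz' Cs1' C2; rewrite !{}pull !{}FD.
move: (F x x a) (F x x w) (F x y a) (F x y w) (F y y a) (F y y w).
move=> xx xx' xy xy' yy yy'; rewrite -subr_ge0.
set p := (X in 0 <= X -> _); set q := (X in _ -> 0 <= X).
by have -> : q = p by rewrite /p /q; ring.
Qed.

End Polarization.

(** * Application to the trilinear form of the remaining classes *)

Theorem theorem5p2 (R : realType) (s n : nat) (C : set 'rV[R]_s)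
    (f : mpoly s R)
    (C_open : open C) (C_cone : convex_cone C) (f_lor : lorentzian n C f)
    (Eff : set 'rV[R]_s)
    (Eff_closed : closed Eff) (Eff_cone : convex_cone Eff)
    (Nef_Eff : closure C `<=` Eff)
    (Eff_ge0 : forall (T : 'rV[R]_s) (al : seq 'rV[R]_s), Eff T ->
       size al = (n - 1)%N -> (forall a, a \in al -> closure C a) ->
       0 <= polarization n f (T :: al))
    (L : 'I_(n - 2) -> 'rV[R]_s)
    (L_nef : forall k, closure C (L k)) (L_crit : critical n C f L)
    (gens : set 'rV[R]_s)
    (gens_Eff : gens `<=` Eff)
    (gens_hull : closed_conic_hull gens = Eff)
    (gens_ker_fin : finite_set (gens `&` kernel n f (codom L)))
    (gens_sign : forall (D : 'rV[R]_s) (al : seq 'rV[R]_s), gens D ->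
       size al = (n - 3)%N -> (forall a, a \in al -> closure C a) ->
       (num_pos_eigenvalues
          (fun x y => polarization n f [:: x, y, D & al]) <= 1)%N)
    (r : 'I_(n - 2)) (alpha : 'rV[R]_s)
    (alpha_ker : kernel n f (codom L) alpha) :
  exists beta : 'rV[R]_s,
    linear_span (gens `&` kernel n f (codom L)) (beta - alpha) /\
    dual_cone Eff
      (fun v => - product_form n f
                    [:: beta, beta & [seq L k | k in predC1 r]] v).
Proof.
(* The index [r] exists, so the truncated subtractions [n - 2] and [n - 3] are genuine. *)
have n3 : (3 <= n)%N.
  by have := leq_ltn_trans (leq0n r) (ltn_ord r); rewrite subn_gt0.
have n_ge2 : (2 <= n)%N by exact: ltnW.
pose vs := [seq L k | k in predC1 r].
have size_vs : size vs = (n - 3)%N by rewrite size_image cardC1 card_ord -subnS.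
have vs_nef v : v \in vs -> closure C v by case/mapP => k _ ->.
have n_eq : n = (n - 3).+3 by rewrite -addn3 subnK.
pose T x y z := polarization n f [:: x, y, z & vs].
have TC12 x y z : T x y z = T y x z by exact: polarizationC12.
have TC23 x y z : T x y z = T x z y.
  apply: polarization_perm; rewrite perm_cons.
  exact/permPl/(perm_catCA [:: y] [:: z] vs).
(* Splitting off [L r] identifies the kernel of the full product with the set [K] attached to
   [l = L r]. *)
have perm_codom : perm_eq (codom L) (L r :: vs).
  rewrite -[L r :: vs]/(map L (r :: enum (predC1 r))); apply: perm_map.
  apply: uniq_perm; rewrite ?enum_uniq //= ?mem_enum ?inE ?eqxx ?enum_uniq //.
  by move=> k; rewrite !inE !mem_enum !inE; case: eqP.
have kerE : kernel n f (codom L) = [set a | forall v, T (L r) a v = 0].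
  have E a v : product_form n f (a :: codom L) v = T (L r) a v.
    rewrite TC23 TC12 TC23; apply: polarization_perm; rewrite !perm_cons.
    exact: perm_codom.
  by apply/seteqP; split=> a /= + v => /(_ v); rewrite E.
(* A point of the closure of [C] witnesses that [C] is nonempty. *)
have [w [Cw _]] := L_nef r _ filterT.
rewrite kerE in gens_ker_fin alpha_ker *.
have [||||beta [beta_span beta_le0]] := @exists_shift_le0 R s T C Eff gens (L r) w
    TC12 TC23 _ C_open C_cone Cw (L_nef r) Nef_Eff gens_Eff gens_hull _ _ _
    gens_ker_fin alpha alpha_ker.
- move=> x y a u v; rewrite !(TC23 x y) !(TC12 x).
  exact: (polarization_scalar n f [:: x, y & vs] a u v).
- move=> x y z Ex Cy Cz; apply: Eff_ge0; rewrite /= ?size_vs //; first by rewrite {2}n_eq subn1.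
  by move=> a; rewrite !inE => /predU1P[->|/predU1P[->|/vs_nef]].
- move=> D x y gD yyD; apply: (reverse_cauchy_schwarz (q := fun x y => T x y D)) => //.
    move=> u a v v'; rewrite !(TC12 u).
    exact: (polarization_scalar n f [:: u, D & vs] a v v').
  exact: gens_sign.
- move=> x y Cy.
  apply: (@lorentzian_alexandrov_fenchel _ _ n C f x y (w :: vs)) => //.
  + by exists w.
  + by rewrite /= size_vs {2}n_eq subn2.
  + by move=> v; rewrite inE => /predU1P[->|/vs_nef //]; exact: subset_closure.
exists beta; split=> //; split=> [a u v|v Ev].
  by rewrite /product_form polarization_scalar opprD mulrN.
rewrite oppr_ge0 /product_form -/(T v beta beta) TC12 TC23.
exact: beta_le0.
Qed.
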